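(* Let $(E,\mathcal{B},P,B_0,\alpha)$ be a conservative interleaving bandit with $E=[L]$, matroid rank $K$ and $\alpha=1/K$, and let the algorithm I-UCB1 be run on it with horizon $n$ (a multiple of $K$). Let $A_1,\dots,A_n$ be the successive actions (bases) taken by I-UCB1. Then, with probability at least $1-\frac{2L}{Kn}$, for every step $t\in[n]$ there exists a bijection $\rho_{A_t,B_0}:A_t\to B_0$ such that $$\sum_{e\in A_t}\mathbf{1}\{\bar w(e)\ge \bar w(\rho_{A_t,B_0}(e))\}\ \ge\ (1-\alpha)K \;=\; K-1 .$$
   Context: **Problem.** A conservative interleaving bandit is a tuple $(E,\mathcal{B},P,B_0,\alpha)$: $E=[L]=\{1,\dots,L\}$ is a finite set of items; $\mathcal{B}$ is the collection of bases of a matroid on $E$ of rank $K$ (each basis has $K$ elements); $P$ is a probability distribution on $[0,1]^L$ (unknown to the learner); $B_0\in\mathcal{B}$ is the input baseline basis; $\alpha\in[0,1]$ is a tolerance. $\bar w=\mathbb{E}_{w\sim P}[w]\in[0,1]^L$ denotes the vector of expected weights. Each time the learner takes an action $A\in\mathcal{B}$, a fresh weight vector $w\sim P$, independent of the past, is drawn, and the learner observes $w(e)$ for every $e\in A$ (semi-bandit feedback). **Bijective exchange (known matroid fact).** For any two bases $B_1,B_2$ there is a bijection $\rho:B_1\to B_2$ such that $(B_1\setminus\{e\})\cup\{\rho(e)\}\in\mathcal{B}$ for every $e\in B_1$. **Algorithm I-UCB1 (the means $\bar w(e)$, $e\in B_0$, are known to the learner).** Let $c_{n,s}=\sqrt{1.5\log(n)/s}$.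 Initialization: one vector $w_0\sim P$ is observed in full, so every item has one observation. The algorithm then proceeds in rounds $r=1,2,\dots,n/K$; each round consists of $K$ actions, so there are $n$ actions (steps) in total. For item $e$ let $T_{r-1}(e)$ be the number of observations of $e$ made before round $r$ (including the initial one), and let $\hat w_{s}(e)$ be the average of its first $s$ observed weights. In round $r$: 1. Compute, for all $e\in E$, $U_r(e)=\hat w_{T_{r-1}(e)}(e)+c_{n,T_{r-1}(e)}$ and $L_r(e)=\max\{\hat w_{T_{r-1}(e)}(e)-c_{n,T_{r-1}(e)},0\}$. 2. Let the decision set $D_r$ be a maximum-weight basis with respect to the weights $U_r$. 3. Set $v_r(e)=\bar w(e)$ for $e\in B_0$ and $v_r(e)=L_r(e)$ for $e\in E\setminus B_0$; let the baseline set $B_r$ be a maximum-weight basis with respect to the weights $v_r$. 4. Let $\rho_r:B_r\to D_r$ be a bijection as in the bijective exchange fact. For each $e\in B_r$ in turn, take the action $(B_r\setminus\{e\})\cup\{\rho_r(e)\}$, observe the weights of its items under a fresh draw from $P$, and update the statistics. *)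

(* Defs.v *)
From HB Require Import structures.
From mathcomp Require Import all_boot all_order all_algebra.
From mathcomp Require Import all_classical all_reals all_analysis.

Set Implicit Arguments.
Unset Strict Implicit.
Unset Printing Implicit Defensive.

Import Order.TTheory GRing.Theory Num.Theory.

Local Open Scope classical_set_scope.
Local Open Scope ring_scope.

(* Items are indexed from 0: E is the ordinal type of size L. *)

Definition is_matroid_bases (L : nat) (bases : {set {set 'I_L}}) : Prop :=
  (exists B, B \in bases) /\
  forall B1 B2, B1 \in bases -> B2 \in bases ->
    forall e, e \in B1 :\: B2 ->
      exists2 f, f \in B2 :\: B1 & f |: (B1 :\ e) \in bases.

Record cibandit (R : realType) (L K : nat) := CIBandit {
  bases : {set {set 'I_L}};
  bases_matroid : is_matroid_bases bases;
  bases_rank : forall B, B \in bases -> #|B| = K;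
  law : probability (L.-tuple R) R;
  law01 : law [set x | forall e, 0 <= tnth x e <= 1] = 1%E;
  baseline : {set 'I_L};
  baseline_basis : baseline \in bases;
  alpha : R;
  alpha01 : 0 <= alpha <= 1 }.

Definition wbar (R : realType) (L K : nat) (M : cibandit R L K) (e : 'I_L) : R :=
  fine ('E_(law M)[fun x => tnth x e])%E.

Definition set_bijection (L : nat) (A B : {set 'I_L}) (rho : 'I_L -> 'I_L) : Prop :=
  {in A &, injective rho} /\ (rho @: A)%SET = B.

Definition max_weight_basis (R : realType) (L K : nat) (M : cibandit R L K)
    (u : 'I_L -> R) (B : {set 'I_L}) : Prop :=
  B \in bases M /\
  forall B', B' \in bases M -> \sum_(e in B') u e <= \sum_(e in B) u e.

Definition exchange_bijection (R : realType) (L K : nat) (M : cibandit R L K)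
    (B D : {set 'I_L}) (rho : 'I_L -> 'I_L) : Prop :=
  set_bijection B D rho /\
  forall e, e \in B -> rho e |: (B :\ e) \in bases M.

(* One realisation of the interaction: [x 0] is the fully observed initial
   vector; for t >= 1, [a t] is the action of step t and [x t] is the weight
   vector drawn at that step. *)
Section Statistics.
Variables (R : realType) (L : nat).
Variables (x : nat -> L.-tuple R) (a : nat -> {set 'I_L}).

Definition observed (m : nat) (e : 'I_L) : seq R :=
  tnth (x 0%N) e :: [seq tnth (x t) e | t <- iota 1 m & e \in a t].

Definition nobs (m : nat) (e : 'I_L) : nat := size (observed m e).

Definition what (m : nat) (e : 'I_L) : R :=
  (\sum_(y <- observed m e) y) / (nobs m e)%:R.

Definition conf_radius (n s : nat) : R :=
  Num.sqrt (3%:R / 2%:R * ln (n%:R : R) / s%:R).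

Definition ucb (n m : nat) (e : 'I_L) : R :=
  what m e + conf_radius n (nobs m e).

Definition lcb (n m : nat) (e : 'I_L) : R :=
  Num.max (what m e - conf_radius n (nobs m e)) 0.

End Statistics.

(* Rounds are indexed from 0: round r starts after the first r * K steps and
   consists of the steps r * K + 1, ..., r * K + K. The sequence [s] is the
   order in which the items of the baseline set [B] are exchanged. *)
Definition iucb1_round (R : realType) (L K : nat) (M : cibandit R L K) (n : nat)
    (x : nat -> L.-tuple R) (a : nat -> {set 'I_L}) (r : nat)
    (D B : {set 'I_L}) (rho : 'I_L -> 'I_L) (s : K.-tuple 'I_L) : Prop :=
  [/\ max_weight_basis M (ucb x a n (r * K)) D,
      max_weight_basis M
        (fun e => if e \in baseline M then wbar M e else lcb x a n (r * K) e) B,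
      exchange_bijection M B D rho,
      perm_eq s (enum B) &
      forall j : 'I_K,
        a (r * K + j).+1 = rho (tnth s j) |: (B :\ tnth s j)].

(* Ties among maximum-weight bases, the exchange bijection and the order of the
   exchanges are left unspecified, and may differ between realisations. *)
Definition iucb1_path (R : realType) (L K : nat) (M : cibandit R L K) (n : nat)
    (x : nat -> L.-tuple R) (a : nat -> {set 'I_L}) : Prop :=
  forall r, (r < n %/ K)%N -> exists D B rho s, iucb1_round M n x a r D B rho s.

(* The past of the draw [w t]: all previous draws and the actions of the steps
   1, ..., t, the action of step t being chosen before [w t] is drawn. *)
Definition past (R : realType) (L : nat) (T : Type)
    (w : nat -> T -> L.-tuple R) (A : nat -> T -> {set 'I_L}) (t : nat) :
    set (set T) :=
  <<s [set H | (exists s S, [/\ (s < t)%N, measurable S & H = w s @^-1` S]) \/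
               (exists s a, (0 < s <= t)%N /\ H = [set o | A s o = a])] >>.

(* The last clause says both that [w t] has law [law M] (take [H := setT]) and
   that it is independent of the past. *)
Definition bandit_protocol (R : realType) (L K : nat) (M : cibandit R L K)
    (n : nat) (d : measure_display) (T : measurableType d)
    (P : probability T R) (w : nat -> T -> L.-tuple R)
    (A : nat -> T -> {set 'I_L}) : Prop :=
  [/\ forall t, (t <= n)%N -> measurable_fun setT (w t),
      forall t a, (0 < t <= n)%N -> measurable [set o | A t o = a] &
      forall t, (t <= n)%N -> forall H S, past w A t H -> measurable S ->
        P (H `&` w t @^-1` S) = (P H * law M S)%E].

(* Main.v *)
Require Import Defs.
From HB Require Import structures.
From mathcomp Require Import all_boot all_order all_algebra.
From mathcomp Require Import all_classical all_reals all_analysis.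
From mathcomp Require Import measurable_realfun zify ring lra.

(* Put v = wbar on the baseline basis B0 and v = lcb elsewhere. If v <= wbar
   everywhere, optimality of B_r for v gives a bijection s : B_r -> B0 with
   wbar (s e) = v (s e) <= v e <= wbar e; an action differs from B_r in a single
   item, so at most one of these K comparisons is lost.

   The bound lcb <= wbar fails at the start of some round only if the first s
   observations of some item deviate by more than the confidence radius c, for
   some s <= n. The number of observations is random, but by Hoeffding's lemma
   and the independence of each draw from the past,
     exp (sum over the observations y of e of (l (y - wbar e) - l^2 / 8))
   is a supermartingale with mean at most 1. With l = 4 c and s c^2 = 3/2 ln n
   the exponent is at least 3 ln n on the deviation event, whose probability is
   therefore at most n^-3. There are n/K rounds, n values of s and L items, so
   the failure probability is at most L / (K n). *)

Set Implicit Arguments.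
Unset Strict Implicit.
Unset Printing Implicit Defensive.

Import Order.TTheory GRing.Theory Num.Theory.
Import numFieldNormedType.Exports.

Local Open Scope classical_set_scope.
Local Open Scope ring_scope.

(** * Basis exchange and item-wise domination by a maximum-weight basis *)

Section MatroidExchange.
Variables (R : realType) (L : nat).
Implicit Types (v : 'I_L -> R) (B C : {set 'I_L}) (bases : {set {set 'I_L}}).

(** The incoming item [e] inherits the partner of the outgoing item [f]. Excluding [e] from [B :\ f]
    rather than from [B] allows [e = f], which occurs when the exchange bijection of a round fixes
    an item. *)
Lemma set_bijection_exchange B C (s : 'I_L -> 'I_L) (e f : 'I_L) :
  e \notin B :\ f -> f \in B -> set_bijection B C s ->
  set_bijection (e |: (B :\ f)) C (fun x => if x == e then s f else s x).
Proof.
move=> eB fB [sI sC].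
have Ne x : x \in B :\ f -> (x == e) = false.
  by move=> xB; apply: contraNF eB => /eqP <-.
have neB z : z \in B :\ f -> s z <> s f.
  by rewrite in_setD1 => /andP[zf zB] /(sI _ _ zB fB) /eqP; rewrite (negbTE zf).
split.
- move=> x y; rewrite !in_setU1.
  case/predU1P=> [->|xB]; case/predU1P=> [->|yB] //; rewrite ?eqxx.
  + by rewrite (Ne _ yB) => /esym/(neB _ yB).
  + by rewrite (Ne _ xB) => /(neB _ xB).
  + rewrite !Ne //; apply: sI; first by case/setD1P: xB.
    by case/setD1P: yB.
- rewrite -sC; apply/setP => y; apply/imsetP/imsetP => -[x xB ->].
  + case/setU1P: xB => [->|xB]; first by rewrite eqxx; exists f.
    by rewrite (Ne _ xB); exists x => //; case/setD1P: xB.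
  + have [->|xf] := eqVneq x f; first by exists e; rewrite ?setU11 ?eqxx.
    have xBf : x \in B :\ f by rewrite in_setD1 xf.
    by exists x; rewrite ?Ne // in_setU1 xBf orbT.
Qed.

Lemma sum_exchange v B (e f : 'I_L) : e \notin B -> f \in B ->
  \sum_(x in e |: (B :\ f)) v x = \sum_(x in B) v x - v f + v e.
Proof.
move=> eB fB; rewrite big_setU1 ?inE ?(negbTE eB) ?andbF //=.
by rewrite (big_setD1 f fB) /=; ring.
Qed.

(** Induction on the size of [C :\: B]. Replacing a lightest item [f] of [C :\: B] by some [e] of
    [B :\: C] gives a basis closer to [B]; its bijection is then redirected from [e] to [f], which
    preserves domination because [v f <= v e]. *)
Lemma max_weight_dominates bases v B C : is_matroid_bases bases ->
  B \in bases ->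
  (forall B', B' \in bases -> \sum_(e in B') v e <= \sum_(e in B) v e) ->
  C \in bases ->
  exists s, set_bijection B C s /\ {in B, forall e, v (s e) <= v e}.
Proof.
move=> [_ exch] BB Bmax.
have [k] := ubnP #|C :\: B|; elim: k C => // k IH C; rewrite ltnS => CBk CB.
(* Nested bases coincide: an item of [B] outside [C'] would have to be exchanged for an item of the
   empty set [C' :\: B]. *)
have BC_card (C' : {set 'I_L}) :
    C' \in bases -> C' :\: B = finset.set0 -> C' = B.
  move=> C'B C'B0; apply/eqP.
  rewrite finset.eqEsubset -finset.setD_eq0 C'B0 eqxx /=.
  apply/fintype.subsetP => e eB; apply: contraT => eC.
  have [|f] := exch _ _ BB C'B e; first by rewrite inE eC.
  by rewrite C'B0 inE.
have [CB0|/set0Pn[f0 f0CB]] := eqVneq (C :\: B) finset.set0.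
  rewrite (BC_card _ CB CB0); exists id; split=> //; split; first by move=> ? ?.
  by rewrite finset.imset_id.
(* Minimality of f in C :\: B is what makes the exchange usable: were v e < v f,
   exchanging e out of B would bring in some g with v g >= v f > v e. *)
pose f := [arg min_(x < f0 | x \in C :\: B) v x]%O.
have [fCB fmin] : f \in C :\: B /\ forall x, x \in C :\: B -> v f <= v x.
  by rewrite /f; case: arg_minP.
have [e eBC C'B] := exch _ _ CB BB f fCB.
have [eB eC] : e \in B /\ e \notin C by move: eBC; rewrite inE => /andP[].
have [fC fB] : f \in C /\ f \notin B by move: fCB; rewrite inE => /andP[].
have vfe : v f <= v e.
  have [g gCB B'B] := exch _ _ BB CB e eBC.
  have gB : g \notin B by move: gCB; rewrite inE => /andP[].
  have := Bmax _ B'B; rewrite sum_exchange // => Bmax'.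
  by have := fmin _ gCB; lra.
have [|s [[sI sC'] sv]] := IH _ _ C'B.
  apply: leq_trans CBk; apply: proper_card; apply/fintype.properP; split.
    apply/fintype.subsetP => x; rewrite !inE.
    move=> /andP[xB /predU1P[xe|/andP[_ ->]]].
      by rewrite xe eB in xB.
    by rewrite xB.
  by exists f => //; rewrite !inE eqxx (negbTE fB) orbF;
    apply: contraNneq eC => <-.
have C'E x : (x \in e |: C :\ f) = (x == e) || (x != f) && (x \in C).
  by rewrite !inE.
exists (fun x => if s x == e then f else s x); split; last first.
  move=> x xB; case: eqVneq => [sxe|_]; last exact: sv.
  by rewrite (le_trans vfe) // -sxe sv.
(* The value [f] is free for redirection, since [s] maps onto [e |: C :\ f], which omits [f]. *)
have sNf x : x \in B -> s x <> f.
  move=> xB sxf; have : s x \in e |: C :\ f by rewrite -sC' imset_f.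
  rewrite sxf C'E eqxx orbF => /eqP fe.
  by rewrite -fe fC in eC.
split.
  move=> x y xB yB; case: eqVneq => [sx|sx]; case: eqVneq => [sy|sy] E.
  - by apply: sI => //; rewrite sx sy.
  - by case: (sNf y).
  - by case: (sNf x).
  - exact: sI.
apply/setP => y; apply/imsetP/idP => [[x xB ->]|yC].
  case: eqVneq => // sx.
  have : s x \in e |: C :\ f by rewrite -sC' imset_f.
  by rewrite C'E (negbTE sx) /= => /andP[].
have [->|yf] := eqVneq y f.
  have : e \in (s @: B)%SET by rewrite sC' C'E eqxx.
  by case/imsetP => x xB ex; exists x => //; rewrite -ex eqxx.
have : y \in (s @: B)%SET by rewrite sC' C'E yf yC orbT.
case/imsetP => x xB ys; exists x => //; rewrite -ys; case: eqVneq => // ye.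
by move: yC; rewrite ye (negbTE eC).
Qed.
End MatroidExchange.

(** * Hoeffding's lemma for a Bernoulli law *)

Section Hoeffding.
Variable R : realType.

Lemma ge0_derive_ge_at0 (f df : R -> R) :
  (forall x : R, is_derive x 1 f (df x)) ->
  (forall x, 0 <= x -> 0 <= df x) -> forall x, 0 <= x -> f 0 <= f x.
Proof.
move=> fd df0 x x0; apply: (@ger0_derive1_ndecry R f 0) => //.
- move=> y; rewrite in_itv/= andbT => /ltW y0.
  by rewrite derive1E derive_val df0.
- apply: continuous_subspaceT => y; apply: differentiable_continuous.
  exact/derivable1_diffP.
Qed.

(** Here [q] is the moment generating function of a Bernoulli variable of mean [p], and [f] is the
    logarithmic gap between the two sides. Since [f] and its derivative [g] vanish at 0 and [g] has
    nonnegative derivative, integrating the sign twice gives [0 <= f l]. *)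
Lemma bernoulli_mgf_le (p l : R) : 0 <= p <= 1 -> 0 <= l ->
  1 - p + p * expR l <= expR (l * p + l ^+ 2 / 8%:R).
Proof.
move=> /andP[p0 p1] l0.
pose q (x : R) : R := 1 - p + p * expR x.
have q0 x : 0 < q x.
  have := expR_gt0 x; rewrite /q; move: p0; rewrite le_eqVlt.
  move=> /orP[/eqP <-|p0 ex].
    by rewrite mul0r subr0 addr0.
  by have := mulr_gt0 p0 ex; lra.
pose g (x : R) : R := p + x / 4%:R - p * expR x / q x.
pose f (x : R) : R := x * p + x ^+ 2 / 8%:R - ln (q x).
have dq (x : R) : is_derive x 1 q (p * expR x).
  have := is_deriveD (is_derive_cst (1 - p) x 1)
    (is_deriveZ p (is_derive_expR x)).
  by move/is_derive_eq; apply; rewrite add0r.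
have dg (x : R) : is_derive x 1 g (4%:R^-1 - p * expR x * (1 - p) / q x ^+ 2).
  have qx0 : q x != 0 by rewrite gt_eqF.
  have := is_deriveB (is_deriveD (is_derive_cst p x 1)
      (is_deriveZ 4%:R^-1 (is_derive_id x 1)))
    (is_deriveM (is_deriveZ p (is_derive_expR x)) (is_deriveV qx0 (dq x))).
  have -> : (cst p + 4^-1 \*: id - p \*: expR * (fun y => (q y)^-1))%R = g.
    by apply/funext => y; rewrite /g !fctE /GRing.scale /= [y / _]mulrC.
  move/is_derive_eq; apply; rewrite /GRing.scale /= /q.
  change (p *: expR x) with (p * expR x); field; exact: qx0.
have df (x : R) : is_derive x 1 f (g x).
  have := is_deriveB (is_deriveD (is_deriveZ p (is_derive_id x 1))
      (is_deriveZ 8%:R^-1 (is_deriveX 2 (is_derive_id x 1))))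
    (is_derive1_comp (is_derive1_ln (q0 x)) (dq x)).
  have -> : (p \*: id + 8^-1 \*: id ^+ 2 - ((@ln R) \o q : R -> R))%R = f.
    apply/funext => y.
    by rewrite /f !fctE /GRing.scale /= [y * p]mulrC [_ / 8]mulrC.
  move/is_derive_eq; apply; rewrite /GRing.scale /= /g.
  by field; rewrite gt_eqF.
have g0 x : 0 <= x -> 0 <= g x.
  move=> x0; have -> : 0 = g 0.
    by rewrite /g /q expR0; field; rewrite ?mulr1 subrK oner_neq0.
  apply: (ge0_derive_ge_at0 dg) x0 => y y0.
  (* g' y = 1/4 - t (1 - t) with t = p expR y / q y. *)
  have := sqr_ge0 (q y - 2%:R * (p * expR y)).
  rewrite subr_ge0 ler_pdivrMr ?exprn_gt0 // => H.
  by move: H; rewrite /q; lra.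
have := ge0_derive_ge_at0 df g0 l0.
have -> : f 0 = 0 by rewrite /f /q expR0 mulr1 subrK ln1; ring.
by rewrite /f subr_ge0 -ler_expR lnK ?posrE.
Qed.
End Hoeffding.

(** * Hoeffding's lemma for variables with values in [0, 1] *)

Section HoeffdingMgf.
Local Open Scope ereal_scope.
Context d (T : measurableType d) (R : realType) (P : probability T R).

Lemma measurable_mgf (X : T -> R) (l m c : R) : measurable_fun setT X ->
  measurable_fun setT (fun x => expR (l * (X x - m) - c))%R.
Proof.
move=> mX; apply: measurableT_comp => //; apply: measurable_funB => //.
by apply: measurable_funM => //; exact: measurable_funB.
Qed.

(** On [0, 1] the convex function [expR (l * x)] lies below its chord, which is affine in [x]. The
    expectation of the chord depends only on the mean [mu] and is the Bernoulli moment generating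
    function. *)
Lemma hoeffding_mgf_bounded (X : T -> R) (l : R) : measurable_fun setT X ->
  (forall x, (0 <= X x <= 1)%R) -> (0 <= l)%R ->
  \int[P]_x
    (expR (l * (X x - fine (\int[P]_x (X x)%:E)) - l ^+ 2 / 8%:R))%:E <= 1.
Proof.
move=> mX X01 l0; set mu := fine _.
have EX0 : 0 <= \int[P]_x (X x)%:E.
  by apply: integral_ge0 => x _; rewrite lee_fin; case/andP: (X01 x).
have EX1 : \int[P]_x (X x)%:E <= 1.
  apply: (@le_trans _ _ (\int[P]_x (cst 1 x))); last first.
    by rewrite integral_cst //= probability_setT mule1.
  apply: ge0_le_integral => //.
  - by move=> x _; rewrite lee_fin; case/andP: (X01 x).
  - exact/measurable_EFinP.
  - by move=> x _; rewrite lee_fin; case/andP: (X01 x).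
have EX : \int[P]_x (X x)%:E = mu%:E.
  by rewrite fineK // ge0_fin_numE // (le_lt_trans EX1) // ltry.
have mu01 : (0 <= mu <= 1)%R by rewrite -!lee_fin -EX EX0 EX1.
pose c := expR (- (l * mu + l ^+ 2 / 8%:R)).
have el : (0 <= expR l - 1)%R by rewrite subr_ge0 -expR0 ler_expR.
have cel : (0 <= c * (expR l - 1))%R by rewrite mulr_ge0 ?expR_ge0.
apply: (@le_trans _ _
    (\int[P]_x (c%:E + (c * (expR l - 1))%:E * (X x)%:E))).
  apply: ge0_le_integral => //.
  - by apply/measurable_EFinP; exact: measurable_mgf.
  - apply/measurable_EFinP; apply: measurable_funD => //.
    exact: measurable_funM.
  - move=> x _; rewrite -EFinM -EFinD lee_fin.
    have -> :
        (l * (X x - mu) - l ^+ 2 / 8 = - (l * mu + l ^+ 2 / 8) + l * X x)%R.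
      by ring.
    have x01 := X01 x.
    (* [X x] serves as the weight of [l] against 0 in the convexity inequality. *)
    pose t : {i01 R} := Itv01 (proj1 (andP x01)) (proj2 (andP x01)).
    have := convex_expR t l 0%R.
    rewrite !convRE /= expR0 mulr0 addr0 mulr1 /unstable.onem mulrC => convex.
    have -> : (c + c * (expR l - 1) * X x = c * (1 + (expR l - 1) * X x))%R.
      by ring.
    rewrite expRD -/c.
    rewrite ler_pM2l ?expR_gt0 // (le_trans convex) //; lra.
rewrite ge0_integralD //; last 3 first.
- by move=> x _; rewrite lee_fin expR_ge0.
- move=> x _; have /andP[x0 _] := X01 x; by rewrite lee_fin mulr_ge0.
- by apply/measurable_EFinP; exact: measurable_funM.
rewrite ge0_integralZl //; last 2 first.
- exact/measurable_EFinP.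
- by move=> x _; rewrite lee_fin; case/andP: (X01 x).
rewrite integral_cst //= probability_setT mule1 EX -EFinM -EFinD lee_fin.
have := bernoulli_mgf_le mu01 l0.
have -> : (c + c * (expR l - 1) * mu = (1 - mu + mu * expR l) * c)%R by ring.
rewrite /c expRN.
by rewrite ler_pdivrMr ?expR_gt0 // mul1r; apply: le_trans; lra.
Qed.

(** The weights lie in [0, 1] only almost surely. Clamping gives a version bounded everywhere, with
    the same integrals. *)
Definition clamp01 (x : R) : R := Num.max 0%R (Num.min x 1%R).

Lemma clamp01_itv x : (0 <= clamp01 x <= 1)%R.
Proof. by rewrite /clamp01 le_max lexx /= ge_max ler01 ge_min lexx orbT. Qed.

Lemma measurable_clamp01 (X : T -> R) : measurable_fun setT X ->
  measurable_fun setT (clamp01 \o X).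
Proof.
by move=> mX; apply: measurable_maxr => //; exact: measurable_minr.
Qed.

Section AlmostSurelyBounded.
Variable X : T -> R.
Hypothesis mX : measurable_fun setT X.
Hypothesis X01 : P [set x | (0 <= X x <= 1)%R] = 1.

Let ae_clamp01 : ae_eq P setT X (clamp01 \o X).
Proof.
have mX01 : measurable [set x | (0 <= X x <= 1)%R].
  have -> : [set x | (0 <= X x <= 1)%R] = X @^-1` `[0%R, 1%R]%classic.
    by apply/seteqP; split=> x /=; rewrite in_itv.
  by rewrite -[X in measurable X]setTI; exact: mX.
have PX01 : P (~` [set x | (0 <= X x <= 1)%R]) = 0.
  by rewrite probability_setC // X01 subee.
exists (~` [set x | (0 <= X x <= 1)%R]); split => //.
  exact: measurableC.
move=> x /= /existsNP[_ XYx] x01; apply: XYx; move/andP: x01 => [x0 x1].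
by rewrite /clamp01 (min_idPl x1) (max_idPr x0).
Qed.

Let expectation_clamp01 : 'E_P[X] = \int[P]_x (clamp01 (X x))%:E.
Proof.
rewrite unlock; apply: ae_eq_integral => //.
- exact/measurable_EFinP.
- by apply/measurable_EFinP; exact: measurable_clamp01.
- by apply: filterS ae_clamp01 => x h Dx; have /= <- := h Dx.
Qed.

Lemma fine_expectation_ge0 : (0 <= fine 'E_P[X])%R.
Proof.
rewrite expectation_clamp01 fine_ge0 // integral_ge0 // => x _.
by rewrite lee_fin; case/andP: (clamp01_itv (X x)).
Qed.

Lemma hoeffding_mgf (l : R) : (0 <= l)%R ->
  \int[P]_x (expR (l * (X x - fine 'E_P[X]) - l ^+ 2 / 8%:R))%:E <= 1.
Proof.
move=> l0; have mY := measurable_clamp01 mX.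
rewrite expectation_clamp01.
apply: le_trans (hoeffding_mgf_bounded mY (fun x => clamp01_itv (X x)) l0).
rewrite le_eqVlt; apply/orP; left; apply/eqP; apply: ge0_ae_eq_integral => //.
- by apply/measurable_EFinP; exact: measurable_mgf.
- by apply/measurable_EFinP; exact: measurable_mgf.
- by apply: filterS ae_clamp01 => x h Dx; have /= <- := h Dx.
Qed.
End AlmostSurelyBounded.
End HoeffdingMgf.

(** Applied to actions, which range over a finite type: any property of an action, even the
    existence of a bijection, defines a measurable event. *)
Lemma measurable_finite_valued d (T : measurableType d) (F : finType)
    (X : T -> F) (Q : set F) :
  (forall a, measurable [set o | X o = a]) -> measurable [set o | Q (X o)].
Proof.
move=> mX; have -> : [set o | Q (X o)] = \bigcup_(a in Q) [set o | X o = a].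
  by apply/seteqP; split=> [x Qx|x [a Qa /= ->]//]; exists (X x).
by apply: fin_bigcup_measurable => //; exact: finite_finset.
Qed.

(** * Integrating out a variable independent of the past *)

Section Independence.
Local Open Scope ereal_scope.
Context d (T : measurableType d) (R : realType) (P : probability T R).
Context d' (S : measurableType d') (Q : probability S R).
Variables (G : set (set T)) (W : T -> S).
Hypotheses (GT : <<s G >> `<=` measurable) (mW : measurable_fun setT W).
Hypothesis indep : forall H B, <<s G >> H -> measurable B ->
  P (H `&` W @^-1` B) = P H * Q B.

(* [iG] pushes P forward to the sub-sigma-algebra generated by G; independence
   says that the law of [iGW] is a product measure. *)
Let TG : measurableType _ := g_sigma_algebraType G.
Let iG : T -> TG := id.
Let miG : measurable_fun setT iG.
Proof. by move=> _ B mB; rewrite setTI; exact: GT. Qed.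
Let iGW o : TG * S := (iG o, W o).
Let miGW : measurable_fun setT iGW.
Proof. exact: measurable_fun_pair. Qed.

(** This replaces conditional expectation given the past: the first argument of [f] carries the past
    and is frozen while the fresh draw is integrated under its own law, by Tonelli. *)
Lemma integral_independent (f : TG * S -> \bar R) :
  measurable_fun setT f -> (forall z, 0 <= f z) ->
  \int[P]_o f (o, W o) = \int[P]_o \int[Q]_x f (o, x).
Proof.
move=> mf f0.
pose XG : {mfun T >-> TG} := HB.pack iG (isMeasurableFun.Build _ _ _ _ iG miG).
pose XGW : {mfun T >-> (TG * S)%type} :=
  HB.pack iGW (isMeasurableFun.Build _ _ _ _ iGW miGW).
pose PG := distribution P XG; pose PGW := distribution P XGW.
transitivity (\int[PGW]_z f z); first by rewrite ge0_integral_distribution.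
(* A product measure is determined by rectangles, on which the equality is [indep]. *)
have PGE X : measurable X -> (PG \x Q) X = PGW X.
  by apply: product_measure_unique => H B mH mB; exact: indep.
rewrite (eq_measure_integral (PG \x Q)); last first.
  by move=> X mX _; exact: (esym (PGE X mX)).
rewrite fubini_tonelli1 // ge0_integral_distribution //.
- exact: measurable_fun_fubini_tonelli_F.
- by move=> y; apply: integral_ge0.
Qed.
End Independence.

(** * The exponential supermartingale of the observations of an item *)

Section Supermartingale.
Context (R : realType) (L K : nat) (M : cibandit R L K) (n : nat).
Context (d : measure_display) (T : measurableType d) (P : probability T R).
Variables (w : nat -> T -> L.-tuple R) (A : nat -> T -> {set 'I_L}).
Hypothesis protocol : bandit_protocol M n P w A.

(** These are the generators of [past w A t]. *)
Let G t : set (set T) :=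
  [set H | (exists s S, [/\ (s < t)%N, measurable S & H = w s @^-1` S]) \/
           (exists s a, (0 < s <= t)%N /\ H = [set o | A s o = a])].

Let TG t : measurableType _ := g_sigma_algebraType (G t).

Let past_measurable t : (t <= n)%N -> <<s G t >> `<=` measurable.
Proof.
have [mw mA _] := protocol.
move=> tn; apply: smallest_sub; first exact: sigma_algebra_measurable.
move=> H [[s [S [st mS ->]]]|[s [a [/andP[s0 st] ->]]]].
  by rewrite -[X in measurable X]setTI; apply: mw => //; lia.
by apply: mA; rewrite s0 (leq_trans st).
Qed.

Let measurable_w s t : (s < t)%N -> measurable_fun [set: TG t] (w s).
Proof.
move=> st _ S mS; rewrite setTI; apply: sub_sigma_algebra.
by left; exists s, S.
Qed.

Let observes (e : 'I_L) i o := (i == 0%N) || (e \in A i o).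

(** The bound is [s <= t], against [s < t] for weights: the action of step [t] is chosen before the
    draw [w t]. *)
Let measurable_observes e s t : (s <= t)%N ->
  measurable_fun [set: TG t] (observes e s).
Proof.
case: s => [_|s st]; first exact: measurable_cst.
apply: (@measurable_fun_bool _ _ _ _ true); rewrite setTI.
have mQ : measurable
    ([set o | [set a : {set 'I_L} | e \in a] (A s.+1 o)] : set (TG t)).
  apply: measurable_finite_valued => a.
  by apply: sub_sigma_algebra; right; exists s.+1, a.
exact: mQ.
Qed.

(** Unobserved draws contribute 0, so a sum with a random number of observations becomes one over a
    fixed range. It stops before draw [k], hence is determined by the past of that draw. *)
Definition gain (phi : L.-tuple R -> R) (e : 'I_L) (k : nat) (o : T) : R :=
  \sum_(i < k) if (i == 0 :> nat) || (e \in A i o) then phi (w i o) else 0.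

Variables (phi : L.-tuple R -> R) (e : 'I_L).
Hypothesis mphi : measurable_fun setT phi.

Let measurable_past_gain k t : (k <= t)%N ->
  measurable_fun [set: TG t] (gain phi e k).
Proof.
move=> kt; apply: measurable_sum => i.
have it : (i < t)%N by apply: leq_trans kt.
apply: measurable_fun_ifT; last exact: measurable_cst.
  exact: (measurable_observes e (ltnW it)).
exact: (measurableT_comp mphi (measurable_w it)).
Qed.

Lemma measurable_gain k : (k <= n.+1)%N -> measurable_fun setT (gain phi e k).
Proof.
have [mw mA _] := protocol.
move=> kt; apply: measurable_sum => i.
have it : (i <= n)%N by rewrite -ltnS (leq_trans _ kt).
apply: measurable_fun_ifT; last exact: measurable_cst.
  move=> _ B mB; apply: (past_measurable it).
  exact: (measurable_observes e (leqnn i)).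
exact: (measurableT_comp mphi (mw _ it)).
Qed.

Local Open Scope ereal_scope.

(** Induction on [k]. Given the past, whether draw [k] shows [e] is already decided: if so, it
    contributes a factor of integral at most 1; if not, the factor is 1. *)
Lemma expectation_expR_gain_le1 k : (k <= n.+1)%N ->
  \int[law M]_x (expR (phi x))%:E <= 1 ->
  \int[P]_o (expR (gain phi e k o))%:E <= 1.
Proof.
have [mw mA ind] := protocol.
move=> kn phi1; elim: k kn => [_|k IH].
  under eq_integral do rewrite /gain big_ord0 expR0.
  by rewrite integral_cst //= probability_setT mule1.
rewrite ltnS => kn; apply: le_trans (IH (leqW kn)).
(* The past and the fresh draw become separate arguments, as [integral_independent] requires. *)
pose f (z : TG k * L.-tuple R) : \bar R :=
  (expR (gain phi e k z.1 + if observes e k z.1 then phi z.2 else 0))%:E.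
have mf : measurable_fun setT f.
  apply/measurable_EFinP; apply: measurableT_comp => //.
  apply: measurable_funD.
    apply: (@measurableT_comp _ _ _ _ _ _ (gain phi e k : TG k -> R)) => //.
    exact: measurable_past_gain.
  apply: measurable_fun_ifT => //.
    apply: (@measurableT_comp _ _ _ _ _ _ (observes e k : TG k -> bool)) => //.
    exact: measurable_observes.
  exact: measurableT_comp.
under eq_integral => o _.
  rewrite (_ : (expR _)%:E = f (o, w k o)); last first.
    by rewrite /f /gain big_ord_recr.
  over.
rewrite (@integral_independent _ _ _ P _ _ (law M) (G k) (w k)) //;
  last 4 first.
- exact: past_measurable.
- exact: mw.
- exact: ind.
- by move=> z; rewrite lee_fin expR_ge0.
apply: ge0_le_integral => //.
- by move=> o _; apply: integral_ge0 => x _; rewrite lee_fin expR_ge0.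
(* Tonelli gives measurability for the past; [past_measurable] transfers it to the sigma-algebra of
   [T]. *)
- have mF : measurable_fun [set: TG k] (fun o => \int[law M]_x f (o, x)).
    by apply: measurable_fun_fubini_tonelli_F => // z; rewrite lee_fin expR_ge0.
  by move=> _ B mB; apply: (past_measurable kn); exact: mF.
- apply/measurable_EFinP; apply: measurableT_comp => //.
  by apply: measurable_gain; exact: leqW.
move=> o _; rewrite /f /=; case: (observes e k o).
  under eq_integral do rewrite expRD EFinM.
  rewrite ge0_integralZl //.
  - by rewrite -[leRHS]mule1 lee_pmul2l // lte_fin expR_gt0.
  - by apply/measurable_EFinP; apply: measurableT_comp.
under eq_integral do rewrite addr0.
by rewrite integral_cst //= probability_setT mule1.
Qed.
End Supermartingale.

(** * Deterministic facts about actions and confidence bounds *)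

Section Deterministic.
Context (R : realType) (L K : nat) (M : cibandit R L K) (n : nat).

(** The items kept from [B] keep their partners in the baseline, and there [wbar M (s x) = v (s x)
    <= v x <= wbar M x]. Only the comparison at the incoming item [f] may fail. *)
Lemma action_dominates_baseline (v : 'I_L -> R) (B : {set 'I_L}) (e f : 'I_L) :
  {in baseline M, forall x, v x = wbar M x} -> (forall x, v x <= wbar M x) ->
  max_weight_basis M v B -> e \in B -> f |: (B :\ e) \in bases M ->
  exists rho, set_bijection (f |: (B :\ e)) (baseline M) rho /\
    K.-1%:R <= \sum_(x in f |: (B :\ e))
                 ((wbar M (rho x) <= wbar M x)%R : nat)%:R :> R.
Proof.
move=> vB0 vw [BB Bmax] eB AB.
have [s [sB sv]] :=
  max_weight_dominates (bases_matroid M) BB Bmax (baseline_basis M).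
have cardBe : #|B :\ e| = K.-1.
  by have := cardsD1 e B; rewrite eB (bases_rank BB) => ->.
have K0 : (0 < K)%N.
  by rewrite -(bases_rank BB) card_gt0; apply/set0Pn; exists e.
(* Otherwise the action would have only [K.-1] items. *)
have fB : f \notin B :\ e.
  apply/negP => fB; have := bases_rank AB.
  by rewrite finset.setUC (finset.setUidPl _) ?finset.sub1set // cardBe; lia.
exists (fun x => if x == f then s e else s x); split.
  exact: set_bijection_exchange.
rewrite big_setU1 //= -[leLHS]add0r lerD ?ler0n //.
rewrite (eq_bigr (fun=> 1)) ?sumr_const ?cardBe // => x xBe.
have /negbTE -> : x != f by apply: contraNneq fB => <-.
have xB : x \in B by case/setD1P: xBe.
suff -> : wbar M (s x) <= wbar M x by [].
have sxB0 : s x \in baseline M by case: sB => _ <-; exact: imset_f.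
by rewrite -(vB0 _ sxB0) (le_trans (sv _ xB)).
Qed.

(** Links the fixed-range sums of the supermartingale to the lists behind the statistics; the draws
    0 to [m] account for the [m.+1] terms. *)
Lemma gain_observed (T : Type) (w : nat -> T -> L.-tuple R)
    (A : nat -> T -> {set 'I_L}) (g : R -> R) (e : 'I_L) (m : nat) (o : T) :
  \sum_(i < m.+1)
    (if (i == 0 :> nat) || (e \in A i o) then g (tnth (w i o) e) else 0)
  = \sum_(y <- observed (w^~ o) (A^~ o) m e) g y.
Proof.
rewrite big_ord_recl /= /observed big_cons; congr (_ + _).
rewrite big_map big_filter.
rewrite -(big_mkord xpredT
  (fun i => if (e \in A i.+1 o) then g (tnth (w i.+1 o) e) else 0)).
rewrite -[iota 1 m]/(iota (1 + 0) m) iotaDl big_map /index_iota subn0.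
by rewrite [RHS]big_mkcond.
Qed.

Lemma sum_affine_observed (x : nat -> L.-tuple R) a m (e : 'I_L) (l mu c : R) :
  \sum_(y <- observed x a m e) (l * (y - mu) - c) =
  (nobs x a m e)%:R * (l * (what x a m e - mu) - c).
Proof.
rewrite /what; have : (nobs x a m e)%:R != 0 :> R by rewrite pnatr_eq0.
rewrite /nobs; move: (observed x a m e) => s s0.
transitivity (l * \sum_(y <- s) y - (size s)%:R * (l * mu + c)).
  elim: s {s0} => [|y s IH]; first by rewrite !big_nil mul0r mulr0 subr0.
  by rewrite !big_cons IH /= -[in RHS]natr1; ring.
by field.
Qed.

Lemma nobs_le (x : nat -> L.-tuple R) a m (e : 'I_L) :
  (0 < nobs x a m e <= m.+1)%N.
Proof.
rewrite /nobs /= ltnS size_map size_filter.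
by rewrite (leq_trans (count_size _ _)) ?size_iota.
Qed.

Lemma conf_radius_sqr (s : nat) : (0 < n)%N -> (0 < s)%N ->
  s%:R * conf_radius R n s ^+ 2 = 3%:R / 2%:R * ln n%:R.
Proof.
move=> n0 s0; rewrite /conf_radius sqr_sqrtr; last first.
  by rewrite !mulr_ge0 ?invr_ge0 ?ler0n // ln_ge0 // ler1n.
by field; rewrite pnatr_eq0 -lt0n.
Qed.

(** By contraposition: if the empirical mean exceeds [wbar] by more than [c], each observation
    contributes on average at least [l * c - l ^+ 2 / 8]. The choice [l = 4 c] maximises this, with
    value [2 c ^ 2]. Nonnegativity of [wbar] covers the truncation of [lcb] at 0. *)
Lemma lcb_le_wbar (x : nat -> L.-tuple R) a m (e : 'I_L)
    (l := 4%:R * conf_radius R n (nobs x a m e)) :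
  (0 < n)%N -> 0 <= wbar M e ->
  \sum_(y <- observed x a m e) (l * (y - wbar M e) - l ^+ 2 / 8%:R)
    < 3%:R * ln n%:R ->
  lcb x a n m e <= wbar M e.
Proof.
move=> n0 w0; have /andP[N0 _] := nobs_le x a m e.
rewrite sum_affine_observed /lcb ge_max w0 andbT => H.
have c2 := conf_radius_sqr n0 N0.
rewrite leNgt; apply/negP => wlt.
have c0 : 0 <= conf_radius R n (nobs x a m e) by exact: sqrtr_ge0.
have N0R : 0 < (nobs x a m e)%:R :> R by rewrite ltr0n.
move: H; rewrite ltNge => /negP; apply.
rewrite /l; set c := conf_radius _ _ _ in c2 wlt c0 *.
set N := (nobs _ _ _ _)%:R in c2 N0R *; set h := what _ _ _ _ in wlt *.
have -> : 3 * ln n%:R = N * (4 * c * c - (4 * c) ^+ 2 / 8) :> R.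
  by transitivity (2 * (N * c ^+ 2)); [rewrite c2|]; field.
rewrite ler_pM2l // lerD2r ler_wpM2l ?mulr_ge0 //; lra.
Qed.
End Deterministic.

(** * Union bound *)

Section UnionBound.
Local Open Scope ereal_scope.
Context d (T : measurableType d) (R : realType) (P : probability T R).

Lemma union_bound_const (I : Type) (s : seq I) (F : I -> set T) (c : R) :
  (forall i, measurable (F i)) -> (forall i, P (F i) <= c%:E) ->
  P (\big[setU/set0]_(i <- s) F i) <= ((size s)%:R * c)%:E.
Proof.
move=> mF PF; elim: s => [|i s IH]; first by rewrite big_nil measure0 mul0r.
rewrite big_cons /= -[in leRHS]natr1 mulrDl mul1r [X in X%:E]addrC EFinD.
apply: le_trans (leeD (PF i) IH); apply: measureU2 => //.
exact: bigsetU_measurable.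
Qed.
End UnionBound.

(** * Deviation probabilities for a fixed item, time and observation count *)

Section Concentration.
Context (R : realType) (L K : nat) (M : cibandit R L K) (n : nat).
Context (d : measure_display) (T : measurableType d) (P : probability T R).
Variables (w : nat -> T -> L.-tuple R) (A : nat -> T -> {set 'I_L}).
Hypothesis protocol : bandit_protocol M n P w A.

Lemma law_tnth01 (e : 'I_L) : law M [set x | (0 <= tnth x e <= 1)%R] = 1%E.
Proof.
have m01 (i : 'I_L) : measurable [set x : L.-tuple R | (0 <= tnth x i <= 1)%R].
  have -> : [set x : L.-tuple R | (0 <= tnth x i <= 1)%R] =
      (fun x => tnth x i) @^-1` `[0%R, 1%R]%classic.
    by apply/seteqP; split=> x /=; rewrite in_itv.
  by rewrite -[X in measurable X]setTI; apply: measurable_tnth.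
have mall : measurable [set x : L.-tuple R | forall i, (0 <= tnth x i <= 1)%R].
  have -> : [set x : L.-tuple R | forall i, (0 <= tnth x i <= 1)%R] =
      \bigcap_(i in setT) [set x : L.-tuple R | (0 <= tnth x i <= 1)%R].
    by apply/seteqP; split=> x /= h i; [move=> _; exact: h|exact: h].
  by apply: fin_bigcap_measurable => //; exact: finite_finset.
apply/eqP; rewrite eq_le probability_le1 //= -(law01 M).
by apply: le_measure; rewrite ?inE // => x; exact.
Qed.

Lemma wbar_ge0 (e : 'I_L) : 0 <= wbar M e.
Proof.
apply: fine_expectation_ge0; first exact: measurable_tnth.
exact: law_tnth01.
Qed.

(** The slope [l] must be deterministic, whereas the observation count is random; [s] is a fixed
    guess for it. *)
Definition increment (s : nat) (e : 'I_L) (y : R) : R :=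
  let l := 4%:R * conf_radius R n s in l * (y - wbar M e) - l ^+ 2 / 8%:R.

Definition deviation (s : nat) (e : 'I_L) (m : nat) : set T :=
  [set o | 3%:R * ln n%:R <=
    gain w A (fun x => increment s e (tnth x e)) e m.+1 o].

Let measurable_increment s e :
  measurable_fun setT (fun x : L.-tuple R => increment s e (tnth x e)).
Proof.
apply: measurable_funB => //; apply: measurable_funM => //.
by apply: measurable_funB => //; exact: measurable_tnth.
Qed.

Lemma measurable_deviation s e m : (m <= n)%N -> measurable (deviation s e m).
Proof.
move=> mn; have mg :=
  measurable_gain protocol e (measurable_increment s e) (mn : (m < n.+1)%N).
rewrite (_ : deviation s e m =
    gain w A (fun x => increment s e (tnth x e)) e m.+1
      @^-1` `[3%:R * ln n%:R, +oo[%classic); last first.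
  by apply/seteqP; split=> o /=; rewrite in_itv /= andbT.
by rewrite -[X in measurable X]setTI; exact: mg.
Qed.

Lemma deviation_le s e m : (0 < n)%N -> (m <= n)%N ->
  (P (deviation s e m) <= (n%:R ^- 3)%:E)%E.
Proof.
move=> n0 mn; have mg :=
  measurable_gain protocol e (measurable_increment s e) (mn : (m < n.+1)%N).
pose X : {RV P >-> R} := HB.pack
  (gain w A (fun x => increment s e (tnth x e)) e m.+1)
  (isMeasurableFun.Build _ _ _ _ _ mg).
(* The Chernoff parameter is 1 because the slope is already built into [increment]. *)
apply: (le_trans (chernoff X (3%:R * ln n%:R) (@ltr01 R))).
have nR : (0 : R) < n%:R by rewrite ltr0n.
have -> : expR (- (1 * (3%:R * ln n%:R))) = n%:R ^- 3 :> R.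
  by rewrite mul1r expRN expRM_natl lnK.
rewrite -[leRHS]mul1e lee_pmul2r ?lte_fin ?invr_gt0 ?exprn_gt0 //.
rewrite /mmt_gen_fun unlock.
under eq_integral do rewrite /= mulr1.
apply: (expectation_expR_gain_le1 protocol e (measurable_increment s e)
  (mn : (m < n.+1)%N)).
apply: (hoeffding_mgf (X := fun x : L.-tuple R => tnth x e)).
- exact: measurable_tnth.
- exact: law_tnth01.
- by rewrite mulr_ge0 // sqrtr_ge0.
Qed.
End Concentration.

(** * Safety of all actions outside the deviation events *)

Theorem theorem1 (R : realType) (L K : nat) (M : cibandit R L K) (n : nat)
    (d : measure_display) (T : measurableType d) (P : probability T R)
    (w : nat -> T -> L.-tuple R) (A : nat -> T -> {set 'I_L}) :
  (0 < K)%N -> (0 < n)%N -> (K %| n)%N ->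
  alpha M = K%:R^-1 ->
  bandit_protocol M n P w A ->
  (forall o : T, iucb1_path M n (fun t => w t o) (fun t => A t o)) ->
  ((1 - (2 * L)%:R / (K * n)%:R)%:E <=
   P [set o | forall t, (0 < t <= n)%N ->
        exists rho : 'I_L -> 'I_L,
          set_bijection (A t o) (baseline M) rho /\
          ((1 - alpha M) * K%:R <=
           \sum_(e in A t o) ((wbar M (rho e) <= wbar M e)%R : nat)%:R)%R])%E.
Proof.
move=> K0 n0 Kn alphaE protocol path.
set safe := [set o | _].
have [q nE] := dvdnP Kn.
have nK : (n %/ K = q)%N by rewrite nE mulnK.
have rKn (r : 'I_q) : (r * K + K <= n)%N.
  by rewrite nE -mulSnr leq_mul2r ltn_ord orbT.
(* The indices are a round, an observation count lowered by one, and an item; statistics at the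
   start of round [r] use the steps up to [r * K]. *)
pose bad (i : 'I_q * 'I_n * 'I_L) :=
  deviation M n w A i.1.2.+1 i.2 (i.1.1 * K)%N.
pose unsafe := \big[setU/set0]_(i <- enum {: 'I_q * 'I_n * 'I_L}) bad i.
have rKn' (r : 'I_q) : (r * K <= n)%N.
  by apply: leq_trans (rKn r); exact: leq_addr.
have mbad i : measurable (bad i) by exact: (measurable_deviation protocol).
have munsafe : measurable unsafe by exact: bigsetU_measurable.
have msafe : measurable safe.
  pose ok (a : {set 'I_L}) := exists rho : 'I_L -> 'I_L,
      set_bijection a (baseline M) rho /\
      ((1 - alpha M) * K%:R <=
        \sum_(e in a) ((wbar M (rho e) <= wbar M e)%R : nat)%:R)%R.
  have -> : safe =
      \bigcap_(t in [set t | (0 < t <= n)%N]) [set o | ok (A t o)] by [].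
  apply: bigcap_measurable => [|t tn]; first by exists 1%N; rewrite /= n0.
  have [_ mA _] := protocol.
  by apply: measurable_finite_valued => a; exact: mA.
have safe_unsafe : ~` unsafe `<=` safe.
  move=> o good t /andP[t0 tn].
  (* Steps count from 1 and rounds from 0, so the quotient and remainder of [t.-1] by [K] locate
     step [t]. *)
  have rq : (t.-1 %/ K < q)%N by rewrite ltn_divLR // -nE; lia.
  pose r := Ordinal rq; pose j := Ordinal (ltn_pmod t.-1 K0).
  have [|D [B [rho [s [Dmax Bmax [rhoB rhoD] sB act]]]]] := path o r.
    by rewrite nK.
  have tE : t = (r * K + j).+1 by rewrite /= -divn_eq prednK.
  have sjB : tnth s j \in B by rewrite -mem_enum -(perm_mem sB) mem_tnth.
  rewrite tE act.
  have -> : (1 - alpha M) * K%:R = K.-1%:R.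
    rewrite alphaE mulrBl mul1r mulVf ?pnatr_eq0 -?lt0n //.
    by rewrite -subn1 natrB.
  apply: action_dominates_baseline Bmax sjB (rhoD _ sjB) => e.
    by move=> eB0; rewrite /= eB0.
  case: ifP => // _; apply: lcb_le_wbar => //; first exact: wbar_ge0.
  set N := nobs _ _ _ _.
  rewrite ltNge; apply/negP => dev; apply: good.
  have /andP[N0 Nr] : (0 < N <= (r * K).+1)%N by exact: nobs_le.
  (* The initial observation makes [N] as large as [r * K + 1], which is still at most [n] because
     round [r] has at least one step. *)
  have Nn : (N.-1 < n)%N by have := rKn r; lia.
  rewrite /unsafe -bigcup_seq; exists (r, Ordinal Nn, e) => /=.
    by rewrite mem_enum.
  have : deviation M n w A N e (r * K) o.
    by rewrite /deviation /= /gain (gain_observed w A (increment M n N e)).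
  by rewrite -(prednK N0).
have Psafe : (P (~` unsafe) <= P safe)%E.
  by apply: le_measure; rewrite ?inE //; exact: measurableC.
apply: le_trans Psafe; rewrite probability_setC // EFinB leeB //.
have Pbad i : (P (bad i) <= (n%:R ^- 3)%:E)%E by exact: deviation_le.
apply: le_trans (union_bound_const _ mbad Pbad) _.
rewrite lee_fin -cardT !card_prod !card_ord.
have n0R : (0 : R) < n%:R by rewrite ltr0n.
rewrite ler_pdivrMr ?exprn_gt0 // mulrAC ler_pdivlMr; last first.
  by rewrite ltr0n muln_gt0 K0.
rewrite -natrX -!natrM ler_nat.
(* As [n = q * K], the union bound amounts to exactly [L / (K n)], half of the allowed failure
   probability. *)
have -> : (q * n * L * (K * n) = L * n ^ 3)%N by rewrite nE; ring.
by rewrite leq_mul2r leq_pmull ?orbT.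
Qed.
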